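(* Let $\mathbb F$ be a field. Let $G_n$, $n=1,2,\ldots$, be a finite or countable sequence of digraphs $G_n=(V_n,E_n)$ with maps $f_n:V_n\to V_{n+1}$. Then the persistent weighted path homology $$H_p(G_1,w_1;\mathbb F)\xrightarrow{(f_1)_*}\cdots\xrightarrow{(f_{n-1})_*}H_p(G_n,w_n;\mathbb F)\xrightarrow{(f_n)_*}H_p(G_{n+1},w_{n+1};\mathbb F)\xrightarrow{(f_{n+1})_*}\cdots$$ is independent of the choice of the non-vanishing weights $w_n:V_n\to\mathbb F$ for which every $f_n:(G_n,w_n)\to(G_{n+1},w_{n+1})$ is a morphism of weighted digraphs. That is, if $(w_n)_n$ and $(w_n')_n$ are two sequences of non-vanishing weights on the $G_n$ such that every $f_n$ is a morphism of weighted digraphs both $(G_n,w_n)\to(G_{n+1},w_{n+1})$ and $(G_n,w'_n)\to(G_{n+1},w'_{n+1})$, then for each $p\geq 0$ there are $\mathbb F$-linear isomorphisms $H_p(G_n,w_n;\mathbb F)\cong H_p(G_n,w'_n;\mathbb F)$ for all $n$ commuting with the maps $(f_n)_*$.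
   Context: Put $R=\mathbb F$ below. A digraph $G=(V,E)$ consists of a finite nonempty set $V$ and a set $E$ of ordered pairs $(u,v)\in V\times V$ with $u\ne v$; write $u\to v$ for $(u,v)\in E$. A weight on $G$ is a function $w:V\to R$; it is non-vanishing if $w(i)\neq 0$ for all $i\in V$. $(G,w)$ is a weighted digraph. For $p\ge 0$, $\Lambda_p(V)$ is the free $R$-module on all sequences (elementary $p$-paths) $e_{i_0\cdots i_p}$, $i_k\in V$; $\Lambda_{-1}(V)=R$ (generated by the empty path) and $\Lambda_{-2}(V)=0$. An elementary path is regular if $i_k\ne i_{k+1}$ for all $k$, otherwise non-regular. $\mathcal R_p(V)$ and $\mathcal I_p(V)$ are the submodules of $\Lambda_p(V)$ generated by the regular, resp. non-regular, elementary $p$-paths, and $\mathcal R_p(V)\cong\Lambda_p(V)/\mathcal I_p(V)$. The weighted boundary operator is $\partial^w e_{i_0\cdots i_p}=\sum_{q=0}^p(-1)^q w(i_q)\,e_{i_0\cdots\widehat{i_q}\cdots i_p}$, extended linearly; it induces $\partial^w:\mathcal R_p(V)\to\mathcal R_{p-1}(V)$ through this isomorphism (i.e. non-regular terms are set to $0$), with $\partial^w\partial^w=0$. An elementary path $e_{i_0\cdots i_p}$ is allowed on $G$ if $i_{k-1}\to i_k$ for all $k=1,\dots,p$. $\mathcal A_p(G)\subseteq\mathcal R_p(V)$ is the submodule generated by allowed elementary $p$-paths ($\mathcal A_{-1}(G)=R$). Put $\Omega^w_p(G)=\{v\in\mathcal A_p(G):\partial^w v\in\mathcal A_{p-1}(G)\}$;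 these form a chain complex under $\partial^w$. The weighted path homology $H_p(G,w;R)$, $p\ge0$, is the $p$-th homology of the truncated complex $\cdots\to\Omega^w_1(G)\to\Omega^w_0(G)\to0$ (the map $\Omega^w_0(G)\to R$ is replaced by $\Omega^w_0(G)\to 0$). The usual (unweighted) path homology is the case $w\equiv1$. A morphism of weighted digraphs $f:(G,w)\to(G',w')$, $G'=(V',E')$, is a map $f:V\to V'$ such that $i\to j$ in $G$ implies $f(i)\to f(j)$ in $G'$ or $f(i)=f(j)$, and $w(i)=w'(f(i))$ for all $i\in V$. The induced map $f_\#:\mathcal R_p(V)\to\mathcal R_p(V')$ sends $e_{i_0\cdots i_p}$ to $e_{f(i_0)\cdots f(i_p)}$ if the latter is regular and to $0$ otherwise; it restricts to a chain map $\{\Omega^w_*(G),\partial^w\}\to\{\Omega^{w'}_*(G'),\partial^{w'}\}$, and $f_*:H_p(G,w;R)\to H_p(G',w';R)$ denotes the induced map on homology. *)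

(* Defs.v *)
From HB Require Import structures.
From mathcomp Require Import all_boot all_order all_algebra.

Set Implicit Arguments.
Unset Strict Implicit.
Unset Printing Implicit Defensive.

Import GRing.Theory.
Local Open Scope ring_scope.
Local Open Scope quotient_scope.

(* The quotient of U by U :&: W, that is U / W when W is contained in U.     *)
Section QuotientSpace.
Variables (K : fieldType) (vT : vectType K) (U W : {vspace vT}).

Definition insubv : {pred subvs_of U} := [pred u | vsval u \in W].

Fact insubv_zmod_closed : zmod_closed insubv.
Proof. by split=> [|u v uW vW]; rewrite inE /= ?mem0v // memvB. Qed.
HB.instance Definition _ :=
  GRing.isZmodClosed.Build (subvs_of U) insubv insubv_zmod_closed.

Definition quotv := Quotient.quot insubv.
HB.instance Definition _ := GRing.Zmodule.on quotv.
HB.instance Definition _ := EqQuotient.on quotv.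
HB.instance Definition _ := ZmodQuotient.on quotv.

Definition quotv_pi (v : vT) : quotv := \pi_quotv (vsproj U v).

Lemma eq_quotv (u v : subvs_of U) :
  (u == v %[mod quotv]) = (vsval u - vsval v \in W).
Proof. by rewrite -Quotient.idealrBE -linearB. Qed.

Definition quotv_scale (a : K) (x : quotv) : quotv := \pi_quotv (a *: repr x).

Lemma pi_quotv_scale a u :
  quotv_scale a (\pi_quotv u) = \pi_quotv (a *: u).
Proof.
apply/eqP; rewrite eq_quotv -linearB -scalerBr linearZ memvZ // linearB.
by rewrite -eq_quotv reprK.
Qed.

Fact quotv_scaleA a b x :
  quotv_scale a (quotv_scale b x) = quotv_scale (a * b) x.
Proof.
by rewrite -[x]reprK (pi_quotv_scale b) !pi_quotv_scale scalerA.
Qed.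

Fact quotv_scale1 : left_id 1 quotv_scale.
Proof. by move=> x; rewrite -[x]reprK pi_quotv_scale scale1r. Qed.

Fact quotv_scaleDr : right_distributive quotv_scale +%R.
Proof.
move=> a x y; rewrite -[x]reprK -[y]reprK.
by rewrite -raddfD /= !pi_quotv_scale scalerDr raddfD.
Qed.

Fact quotv_scaleDl x : {morph quotv_scale^~ x : a b / a + b}.
Proof.
by move=> a b; rewrite -[x]reprK !pi_quotv_scale scalerDl raddfD.
Qed.

HB.instance Definition _ := GRing.Zmodule_isLmodule.Build K quotv
  quotv_scaleA quotv_scale1 quotv_scaleDr quotv_scaleDl.

Fact quotv_pi_linear : linear quotv_pi.
Proof.
by move=> a u v; rewrite /quotv_pi linearP raddfD /= -pi_quotv_scale.
Qed.
HB.instance Definition _ :=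
  GRing.isSemilinear.Build K vT quotv _ quotv_pi
    (GRing.semilinear_linear quotv_pi_linear).

Lemma quotv_piP (x : quotv) : exists2 u, u \in U & x = quotv_pi u.
Proof.
exists (vsval (repr x)); first exact: subvsP.
by rewrite /quotv_pi vsvalK reprK.
Qed.

Lemma eq_quotv_pi u v : u \in U -> v \in U ->
  (quotv_pi u == quotv_pi v) = (u - v \in W).
Proof. by move=> uU vU; rewrite eq_quotv !vsprojK. Qed.

End QuotientSpace.

Section QuotientMap.
Variables (K : fieldType) (vT wT : vectType K).
Variables (U W : {vspace vT}) (U' W' : {vspace wT}) (g : 'Hom(vT, wT)).

(* the two hypotheses are what makes the map independent of the              *)
(* representative, see quotv_mapE                                            *)
Definition quotv_map (_ : (g @: U <= U')%VS) (_ : (g @: W <= W')%VS)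
  (x : quotv U W) : quotv U' W' := quotv_pi U' W' (g (vsval (repr x))).

Hypotheses (gU : (g @: U <= U')%VS) (gW : (g @: W <= W')%VS).

Lemma quotv_mapE u : u \in U ->
  quotv_map gU gW (quotv_pi U W u) = quotv_pi U' W' (g u).
Proof.
move=> uU; have gP v : v \in U -> g v \in U'.
  by move=> vU; apply: (subvP gU); apply: memv_img.
apply/eqP; rewrite eq_quotv_pi ?gP ?subvsP // -linearB /=.
apply: (subvP gW); apply: memv_img; rewrite -(@eq_quotv_pi _ _ U) ?subvsP //.
by rewrite {1}/quotv_pi vsvalK reprK.
Qed.

Fact quotv_map_linear : linear (quotv_map gU gW).
Proof.
move=> a x y.
have [u uU ->] := quotv_piP x; have [v vU ->] := quotv_piP y.
by rewrite -linearP !quotv_mapE ?memvD ?memvZ // !linearP.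
Qed.
HB.instance Definition _ :=
  GRing.isSemilinear.Build K (quotv U W) (quotv U' W') _ (quotv_map gU gW)
    (GRing.semilinear_linear quotv_map_linear).

End QuotientMap.

Section FreeModule.
Variables (F : fieldType) (I : finType).

Definition delta (i : I) : {ffun I -> F^o} := [ffun j => (j == i)%:R].

Lemma delta_sum (v : {ffun I -> F^o}) : v = \sum_i (v i : F) *: delta i.
Proof.
apply/ffunP=> j; rewrite sum_ffunE (bigD1 j) //= !ffunE eqxx.
rewrite big1 ?addr0 => [|i /negPf ij]; first exact/esym/mulr1.
by rewrite !ffunE eq_sym ij scaler0.
Qed.

Variables (vT : vectType F) (b : I -> vT).

Definition linext_fun (v : {ffun I -> F^o}) : vT := \sum_i (v i : F) *: b i.

Fact linext_fun_linear : linear linext_fun.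
Proof.
move=> a u v; rewrite /linext_fun scaler_sumr -big_split /=.
by apply: eq_bigr => i _; rewrite !ffunE scalerDl scalerA.
Qed.
HB.instance Definition _ :=
  GRing.isSemilinear.Build F {ffun I -> F^o} vT _ linext_fun
    (GRing.semilinear_linear linext_fun_linear).

(* the linear map with values b on the basis delta *)
Definition linext : 'Hom({ffun I -> F^o}, vT) := linfun linext_fun.

Lemma linext_delta i : linext (delta i) = b i.
Proof.
rewrite lfunE /= /linext_fun (bigD1 i) //= ffunE eqxx scale1r.
by rewrite big1 ?addr0 // => j /negPf ji; rewrite ffunE ji scale0r.
Qed.

End FreeModule.

Lemma eq_lfun_delta (F : fieldType) (I : finType) (vT : vectType F)
    (g h : 'Hom({ffun I -> F^o}, vT)) :
  (forall i, g (delta F i) = h (delta F i)) -> g = h.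
Proof.
move=> gh; apply/lfunP=> v; rewrite (delta_sum v) !linear_sum.
by apply: eq_bigr => i _; rewrite !linearZ /= gh.
Qed.

Record digraph := Digraph {
  vertex :> finType;
  arrow : rel vertex;
  _ : irreflexive arrow;
  _ : (0 < #|vertex|)%N
}.

Definition regular (V : finType) (s : seq V) : bool :=
  sorted (fun x y => x != y) s.

Definition allowed (G : digraph) (s : seq G) : bool := sorted (@arrow G) s.

(* Chains are indexed by the number of vertices: paths F V k is Lambda_(k-1),*)
(* so that paths F V 0, spanned by the empty path, is Lambda_(-1).           *)
Definition paths (F : fieldType) (V : finType) (k : nat) : vectType F :=
  {ffun k.-tuple V -> F^o}.

Definition face (V : finType) p (q : 'I_p.+1) (t : p.+1.-tuple V) :
  p.-tuple V := [tuple tnth t (lift q i) | i < p].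

Section PathOperators.
Variables (F : fieldType) (V : finType).

(* The projection of Lambda = R (+) I onto R, which realizes the isomorphism *)
(* Lambda / I = R.                                                           *)
Definition reg_proj k : 'Hom(paths F V k, paths F V k) :=
  linext (fun t : k.-tuple V => if regular t then delta F t else 0).

Definition full_boundary (w : V -> F) p : 'Hom(paths F V p.+1, paths F V p) :=
  linext (fun t : p.+1.-tuple V =>
    \sum_(q < p.+1) ((-1) ^+ q * w (tnth t q)) *: delta F (face q t)).

(* Both boundary and push are extended by 0 to the non-regular paths, which  *)
(* does not change them on R (boundary_reg_proj, push_reg_proj).             *)
Definition boundary (w : V -> F) p : 'Hom(paths F V p.+1, paths F V p) :=
  (reg_proj p \o full_boundary w p)%VF.

End PathOperators.

Definition full_push (F : fieldType) (V V' : finType) (f : V -> V') k :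
  'Hom(paths F V k, paths F V' k) :=
  linext (fun t : k.-tuple V => delta F (map_tuple f t)).

Definition push (F : fieldType) (V V' : finType) (f : V -> V') k :
  'Hom(paths F V k, paths F V' k) :=
  (reg_proj F V' k \o full_push F f k)%VF.

Section WeightedPathHomology.
Variables (F : fieldType) (G : digraph).

(* A_(k-1), in the indexing of paths *)
Definition allowed_paths k : {vspace paths F G k} :=
  <<[seq delta F t | t : k.-tuple G in [pred t | allowed (val t)]]>>%VS.

Variables (w : G -> F) (p : nat).

Definition Omega : {vspace paths F G p.+1} :=
  (allowed_paths p.+1 :&: boundary w p @^-1: allowed_paths p)%VS.

(* the differential in degree p of the truncated complex, zero on Omega_0 *)
Definition trunc_boundary : 'Hom(paths F G p.+1, paths F G p) :=
  if p == 0%N then 0 else boundary w p.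

Definition cycles : {vspace paths F G p.+1} :=
  (Omega :&: lker trunc_boundary)%VS.

End WeightedPathHomology.

Definition boundaries (F : fieldType) (G : digraph) (w : G -> F) (p : nat) :
  {vspace paths F G p.+1} := (boundary w p.+1 @: Omega w p.+1)%VS.

Definition path_homology (F : fieldType) (G : digraph) (w : G -> F)
  (p : nat) : lmodType F := quotv (cycles w p) (boundaries w p).

Definition nonvanishing (F : fieldType) (G : digraph) (w : G -> F) : Prop :=
  forall i, w i != 0.

Record wdigraph_morphism (F : fieldType) (G G' : digraph)
    (w : G -> F) (w' : G' -> F) (f : G -> G') : Prop := WdigraphMorphism {
  morphism_arrow : forall i j, arrow i j -> arrow (f i) (f j) \/ f i = f j;
  morphism_weight : forall i, w i = w' (f i)
}.

Section ChainMap.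
Variable F : fieldType.

Lemma reg_proj_delta (V : finType) k (t : k.-tuple V) :
  reg_proj F V k (delta F t) = if regular t then delta F t else 0.
Proof. by rewrite linext_delta. Qed.

Lemma regularPn (V : finType) (s : seq V) x0 : ~~ regular s ->
  exists2 k, (k.+1 < size s)%N & nth x0 s k = nth x0 s k.+1.
Proof.
move=> /(sortedP x0) ns.
have [/existsP[[k /= ks] /andP[/= k1s /eqP eqk]]|/existsPn nex] := boolP
  [exists k : 'I_(size s),
    (k.+1 < size s)%N && (nth x0 s k == nth x0 s k.+1)].
  by exists k.
case: ns => i i1s; have := nex (Ordinal (ltnW i1s)).
by rewrite /= i1s.
Qed.

Lemma nth_eq_regularF (V : finType) (s : seq V) x0 k : (k.+1 < size s)%N ->
  nth x0 s k = nth x0 s k.+1 -> regular s = false.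
Proof.
by move=> ks eqk; apply/negP=> /(sortedP x0)/(_ k ks); rewrite eqk eqxx.
Qed.

Lemma nth_face (V : finType) p (q : 'I_p.+1) (t : p.+1.-tuple V) x0 i :
  (i < p)%N -> nth x0 (face q t) i = nth x0 t (bump q i).
Proof.
move=> ip; rewrite -[i]/(val (Ordinal ip)) -tnth_nth tnth_mktuple.
by rewrite (tnth_nth x0).
Qed.

Lemma boundary_nonregular (V : finType) (w : V -> F) p
    (t : p.+1.-tuple V) :
  ~~ regular t -> boundary w p (delta F t) = 0.
Proof.
move=> nreg; have x0 := tnth t ord0.
have [k] := regularPn x0 nreg; rewrite size_tuple ltnS => kp eqk.
rewrite comp_lfunE linext_delta linear_sum /=.
pose a : 'I_p.+1 := Ordinal (ltnW kp : k < p.+1)%N.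
pose b : 'I_p.+1 := Ordinal (kp : k.+1 < p.+1)%N.
have ba : b != a by rewrite -val_eqE /= gtn_eqF.
rewrite (bigD1 a) //= (bigD1 b) //= big1 ?addr0 => [|q /andP[qa qb]].
  have -> : face b t = face a t.
    apply: eq_from_tnth => i; rewrite !tnth_mktuple !(tnth_nth x0) /= /bump.
    case: (ltngtP k i) => [ki|ik|<-]; first by [].
      by [].
    by rewrite eqk.
  have -> : tnth t b = tnth t a by rewrite !(tnth_nth x0) /= eqk.
  by rewrite !linearZ /= exprS mulN1r mulNr scaleNr addrN.
rewrite linearZ /= reg_proj_delta.
suff -> : regular (face q t) = false by rewrite scaler0.
have {qa qb} [qa qb] : q != k :> nat /\ q != k.+1 :> nat by [].
have sz : size (face q t) = p by rewrite size_tuple.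
have [qk|kq] := ltnP q k.
  case: k kp eqk a b ba qa qb qk => // k kp eqk _ _ _ _ _ qk.
  apply: (@nth_eq_regularF _ _ x0 k); first by rewrite sz.
  rewrite !nth_face ?(ltnW kp) // /bump.
  by rewrite leqW // (_ : (q <= k)%N) // !add1n.
have k1q : (k.+1 < q)%N.
  by rewrite ltn_neqAle eq_sym qb /= ltn_neqAle eq_sym qa.
have k1p : (k.+1 < p)%N by rewrite (leq_trans k1q) // -ltnS.
apply: (@nth_eq_regularF _ _ x0 k).
  by rewrite sz.
rewrite !nth_face ?(ltnW k1p) //.
by rewrite /bump (leqNgt q k) (ltnW k1q) (leqNgt q k.+1) k1q.
Qed.

Lemma boundary_reg_proj (V : finType) (w : V -> F) p :
  (boundary w p \o reg_proj F V p.+1)%VF = boundary w p.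
Proof.
apply: eq_lfun_delta => t; rewrite comp_lfunE reg_proj_delta.
by case: ifPn => // /boundary_nonregular ->; rewrite linear0.
Qed.

Lemma push_reg_proj (V V' : finType) (f : V -> V') k :
  (push F f k \o reg_proj F V k)%VF = push F f k.
Proof.
apply: eq_lfun_delta => t; rewrite comp_lfunE reg_proj_delta.
case: ifPn => // nreg; rewrite linear0 comp_lfunE linext_delta reg_proj_delta.
case: ifP => //; rewrite /regular sorted_map => /sub_sorted reg.
by case/negP: nreg; apply: reg => x y; apply: contraNneq => /= ->.
Qed.

Lemma full_push_boundary (V V' : finType) (w : V -> F) (w' : V' -> F)
    (f : V -> V') p : (forall i, w i = w' (f i)) ->
  (full_push F f p \o full_boundary w p)%VF =
  (full_boundary w' p \o full_push F f p.+1)%VF.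
Proof.
move=> wf; apply: eq_lfun_delta => t.
rewrite !comp_lfunE !linext_delta linear_sum /=; apply: eq_bigr => q _.
rewrite linearZ /= linext_delta tnth_map wf; congr (_ *: delta F _).
by apply: eq_from_tnth => i; rewrite !(tnth_map, tnth_mktuple, tnth_ord_tuple).
Qed.

Lemma push_boundary (V V' : finType) (w : V -> F) (w' : V' -> F)
    (f : V -> V') p : (forall i, w i = w' (f i)) ->
  (push F f p \o boundary w p)%VF = (boundary w' p \o push F f p.+1)%VF.
Proof.
move=> /full_push_boundary fdE.
rewrite [LHS]comp_lfunA push_reg_proj -comp_lfunA fdE comp_lfunA.
by rewrite [RHS]comp_lfunA boundary_reg_proj.
Qed.

Lemma full_boundary_comp (V : finType) (w : V -> F) p :
  (full_boundary w p \o full_boundary w p.+1)%VF = 0.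
Proof.
apply: eq_lfun_delta => t; rewrite comp_lfunE linext_delta zero_lfunE.
pose a (z : 'I_p.+2 * 'I_p.+1) : paths F V p :=
  ((-1) ^+ (z.1 + z.2) * (w (tnth t z.1) * w (tnth t (lift z.1 z.2)))) *:
    delta F (face z.2 (face z.1 t)).
transitivity (\sum_z a z).
  rewrite linear_sum -(pair_big predT predT (fun q r => a (q, r))) /=.
  apply: eq_bigr => q _; rewrite linearZ /= linext_delta scaler_sumr.
  apply: eq_bigr => r _; rewrite scalerA /a /= exprD tnth_mktuple.
  by rewrite mulrACA.
pose h (z : 'I_p.+2 * 'I_p.+1) : 'I_p.+2 * 'I_p.+1 :=
  (lift ord0 z.2, inord z.1).
pose g (z : 'I_p.+2 * 'I_p.+1) : 'I_p.+2 * 'I_p.+1 :=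
  (inord z.2, inord z.1.-1).
rewrite (bigID (fun z : 'I_p.+2 * 'I_p.+1 => z.1 <= z.2)%N) /= [X in _ + X](reindex_onto h g) /=.
  rewrite [X in _ + X](eq_bigl (fun z : 'I_p.+2 * 'I_p.+1 => z.1 <= z.2)%N); last first.
    move=> [q r]; rewrite /h /g /= /bump /= add1n.
    have [qp|pq] := ltnP q p.+1.
      rewrite inordK // -leqNgt; case: eqP => [_|[]]; first exact: andbT.
      by congr pair; apply: val_inj; rewrite /= inordK ?add0n ?ltn_ord.
    rewrite [RHS]leqNgt (leq_trans (ltn_ord r) pq).
    apply/negP=> /andP[_ /eqP[/(congr1 val) /=]].
    have qi := ltn_ord (inord q : 'I_p.+1).
    rewrite inordK ?(leqW qi) // => eq_q.
    by move: qi; rewrite eq_q ltnNge pq.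
  rewrite -big_split /= big1 // => -[q r] /= qr.
  have qp : (q < p.+1)%N by apply: leq_ltn_trans qr _.
  have e1 : lift (lift ord0 r) (inord q : 'I_p.+1) = q.
    by apply: val_inj; rewrite /= /bump /= add1n inordK // ltnNge qr.
  have e2 : lift q r = lift ord0 r.
    by apply: val_inj; rewrite /= /bump /= qr.
  rewrite /a /h /= e1 e2 inordK //.
  have -> : face (inord q) (face (lift ord0 r) t) = face r (face q t).
    apply: eq_from_tnth => i; rewrite !tnth_mktuple; congr (tnth t _).
    apply: val_inj; rewrite /= inordK // /bump /= !add1n.
    have [qi|iq] := leqP q i; rewrite ?add1n ?ltnS.
      have [ri|ir] := leqP r i; first by rewrite add1n leqW.
      by rewrite !add0n qi.
    have ir := leq_trans iq qr.
    by rewrite add0n ltnNge (ltnW ir) (leqNgt r) ir /= !add0n leqNgt iq.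
  rewrite -scalerDl /bump /= add1n addSn exprS mulN1r mulNr [(r + q)%N]addnC.
  by rewrite [w (tnth t (lift ord0 r)) * _]mulrC addrN scale0r.
move=> [q r] /=; rewrite -ltnNge => rq; rewrite /h /g /=.
have q0 : (0 < q)%N := leq_ltn_trans (leq0n r) rq.
have qp : (q.-1 < p.+1)%N by rewrite -ltnS prednK.
have rp : (r < p.+2)%N by apply: leqW.
by congr pair; apply: val_inj; rewrite /= !inordK // /bump add1n prednK.
Qed.
Lemma boundary_comp (V : finType) (w : V -> F) p :
  (boundary w p \o boundary w p.+1)%VF = 0.
Proof.
rewrite [LHS]comp_lfunA boundary_reg_proj -comp_lfunA full_boundary_comp.
exact: comp_lfun0r.
Qed.

Lemma boundaryE (V : finType) (w : V -> F) p (t : p.+1.-tuple V) :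
  boundary w p (delta F t) =
  \sum_(q < p.+1 | regular (face q t))
     ((-1) ^+ q * w (tnth t q)) *: delta F (face q t).
Proof.
rewrite comp_lfunE linext_delta linear_sum /= [RHS]big_mkcond /=.
apply: eq_bigr => q _; rewrite linearZ /= reg_proj_delta.
by case: ifP => _; rewrite ?scaler0.
Qed.

Lemma pushE (V V' : finType) (f : V -> V') k (t : k.-tuple V) :
  push F f k (delta F t) =
  if regular (map f t) then delta F (map_tuple f t) else 0.
Proof. by rewrite comp_lfunE linext_delta reg_proj_delta. Qed.

Lemma boundaries_sub_cycles (G : digraph) (w : G -> F) p :
  (boundaries w p <= cycles w p)%VS.
Proof.
apply/subvP => _ /memv_imgP[u + ->].
rewrite /Omega memv_cap -memv_preim => /andP[uA duA].
have dd0 q (v : paths F G q.+2) : boundary w q (boundary w q.+1 v) = 0.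
  by rewrite -comp_lfunE boundary_comp zero_lfunE.
rewrite !memv_cap -memv_preim duA dd0 mem0v memv_ker /trunc_boundary /=.
by case: (p == 0)%N; rewrite ?zero_lfunE ?dd0.
Qed.

Variables (G G' : digraph) (w : G -> F) (w' : G' -> F) (f : G -> G').
Hypothesis hf : wdigraph_morphism w w' f.

Lemma push_allowed k :
  (push F f k @: allowed_paths F G k <= allowed_paths F G' k)%VS.
Proof.
rewrite limg_span; apply/span_subvP => _ /mapP[_ /imageP[t at_ ->] ->].
rewrite pushE; case: ifP => [reg|_]; last exact: mem0v.
apply: memv_span; apply/imageP; exists (map_tuple f t) => //.
move: at_; rewrite !inE /= /allowed sorted_map => at_.
move: reg; rewrite /regular sorted_map => reg.
have : sorted (fun x y => relpre f (fun x y => x != y) x y && arrow x y) t.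
  by rewrite sorted_relI reg.
apply: sub_sorted => x y /andP[/= /eqP fxy /(morphism_arrow hf)].
by case.
Qed.

Lemma push_Omega p : (push F f p.+1 @: Omega w p <= Omega w' p)%VS.
Proof.
have pA k u : u \in allowed_paths F G k ->
    push F f k u \in allowed_paths F G' k.
  by move=> uA; apply: (subvP (push_allowed k)); apply: memv_img.
apply/subvP => _ /memv_imgP[u + ->].
rewrite /Omega memv_cap -memv_preim => /andP[uA duA].
rewrite memv_cap -memv_preim pA //= -comp_lfunE -(push_boundary p (morphism_weight hf)).
by rewrite comp_lfunE pA.
Qed.

Lemma push_cycles p : (push F f p.+1 @: cycles w p <= cycles w' p)%VS.
Proof.
apply/subvP => _ /memv_imgP[u /memv_capP[uO uK] ->].
rewrite memv_cap (subvP (push_Omega p)) ?memv_img //= memv_ker.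
move: uK; rewrite memv_ker /trunc_boundary; case: (p == 0)%N.
  by move=> _; rewrite zero_lfunE.
rewrite -(comp_lfunE (boundary w' p) (push F f p.+1)) -(push_boundary p (morphism_weight hf)).
by rewrite comp_lfunE => /eqP ->; rewrite linear0.
Qed.

Lemma push_boundaries p :
  (push F f p.+1 @: boundaries w p <= boundaries w' p)%VS.
Proof.
rewrite -limg_comp (push_boundary _ (morphism_weight hf)) limg_comp.
exact/limgS/push_Omega.
Qed.

End ChainMap.

Definition homology_map (F : fieldType) (G G' : digraph) (w : G -> F)
    (w' : G' -> F) (f : G -> G') (hf : wdigraph_morphism w w' f) (p : nat) :
  {linear path_homology w p -> path_homology w' p} :=
  quotv_map (push_cycles hf p) (push_boundaries hf p).

Lemma homology_mapE (F : fieldType) (G G' : digraph) (w : G -> F)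
    (w' : G' -> F) (f : G -> G') (hf : wdigraph_morphism w w' f) p z :
  z \in cycles w p ->
  homology_map hf p (quotv_pi (cycles w p) (boundaries w p) z) =
  quotv_pi (cycles w' p) (boundaries w' p) (push F f p.+1 z).
Proof. exact: quotv_mapE. Qed.

(* The index set of a sequence of length m (N = Some m) or of an infinite    *)
(* sequence (N = None), numbered from 0. Families of objects are total over  *)
(* nat, and their terms outside the index set are irrelevant.                *)
Definition in_range (N : option nat) (n : nat) : bool :=
  if N is Some m then (n < m)%N else true.

(* Main.v *)
Require Import Defs.
From mathcomp Require Import all_boot all_order all_algebra.

(** Multiplying each elementary path e_(i_0...i_p) by the product of the ratios
    c(i_k) = w(i_k) / w'(i_k) intertwines the boundary operators of w and w':
    deleting the vertex i_q from the product loses the factor c(i_q), and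
    c(i_q) w'(i_q) = w(i_q). It is a diagonal automorphism of the space of
    paths, so it preserves allowed paths; and it commutes with the maps induced
    by f because a morphism for both pairs of weights preserves the ratio c. *)

Set Implicit Arguments.
Unset Strict Implicit.
Unset Printing Implicit Defensive.

Import GRing.Theory.
Local Open Scope ring_scope.

Section Rescale.
Variables (F : fieldType) (V : finType).
Implicit Types (c d w : V -> F).

Definition rescale c k : 'Hom(paths F V k, paths F V k) :=
  linext (fun t : k.-tuple V => (\prod_(i < k) c (tnth t i)) *: delta F t).

Lemma rescale_delta c k (t : k.-tuple V) :
  rescale c k (delta F t) = (\prod_(i < k) c (tnth t i)) *: delta F t.
Proof. exact: linext_delta. Qed.

(** Both maps are diagonal in the basis [delta], so discarding non-regular paths commutes with
    rescaling. *)
Lemma rescale_reg_proj c k :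
  (rescale c k \o reg_proj F V k)%VF = (reg_proj F V k \o rescale c k)%VF.
Proof.
apply: eq_lfun_delta => t.
rewrite !comp_lfunE rescale_delta linearZ /= reg_proj_delta.
by case: ifP => _; rewrite ?rescale_delta // linear0 scaler0.
Qed.

Lemma rescaleK c d k : (forall i, d i * c i = 1) ->
  cancel (rescale c k) (rescale d k).
Proof.
move=> dc v; suff dcE : (rescale d k \o rescale c k)%VF = \1%VF.
  by rewrite -comp_lfunE dcE id_lfunE.
apply: eq_lfun_delta => t; rewrite comp_lfunE rescale_delta linearZ /=.
rewrite rescale_delta scalerA mulrC -big_split /= id_lfunE.
by rewrite big1 ?scale1r.
Qed.

Lemma rescale_boundary c w w' p : (forall i, c i * w' i = w i) ->
  (rescale c p \o boundary w p)%VF = (boundary w' p \o rescale c p.+1)%VF.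
Proof.
(* Moving [reg_proj] to the outside on both sides leaves an identity between full boundaries, with
   no regularity test. *)
move=> cw; rewrite [LHS]comp_lfunA rescale_reg_proj -comp_lfunA /boundary -[RHS]comp_lfunA.
congr (_ \o _)%VF; apply: eq_lfun_delta => t.
rewrite !comp_lfunE rescale_delta linearZ /= !linext_delta linear_sum /=.
rewrite scaler_sumr; apply: eq_bigr => q _.
(* Once the factor at [q] is split off, the remaining product runs over [lift q i], which are
   exactly the vertices of [face q t]. *)
rewrite linearZ /= rescale_delta !scalerA (bigD1_ord q) //= -cw.
congr (_ *: _); under eq_bigr do rewrite tnth_mktuple.
by rewrite [_ * (c _ * _)]mulrCA mulrAC.
Qed.

End Rescale.

(** The factor of a path equals that of its image vertex by vertex; if the image is non-regular,
    both sides vanish. *)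
Lemma rescale_push (F : fieldType) (V V' : finType) (f : V -> V')
    (c : V -> F) (c' : V' -> F) k : (forall i, c i = c' (f i)) ->
  (push F f k \o rescale c k)%VF = (rescale c' k \o push F f k)%VF.
Proof.
move=> cf; apply: eq_lfun_delta => t.
rewrite [LHS]comp_lfunE rescale_delta linearZ /= pushE [RHS]comp_lfunE pushE.
case: ifP => _; last by rewrite scaler0 linear0.
rewrite rescale_delta; congr (_ *: _).
by apply: eq_bigr => i _; rewrite cf tnth_map.
Qed.

Section RescaleHomology.
Variables (F : fieldType) (G : digraph).

Lemma rescale_allowed (c : G -> F) k :
  (rescale c k @: allowed_paths F G k <= allowed_paths F G k)%VS.
Proof.
rewrite limg_span; apply/span_subvP => _ /mapP[_ /imageP[t at_ ->] ->].
by rewrite rescale_delta memvZ // memv_span //; apply/imageP; exists t.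
Qed.

Variables c w w' : G -> F.
Hypothesis cw : forall i, c i * w' i = w i.

Lemma boundary_rescale p u :
  boundary w' p (rescale c p.+1 u) = rescale c p (boundary w p u).
Proof. by rewrite -!comp_lfunE (rescale_boundary _ cw). Qed.

Lemma rescale_Omega p : (rescale c p.+1 @: Omega w p <= Omega w' p)%VS.
Proof.
have cA k u : u \in allowed_paths F G k ->
    rescale c k u \in allowed_paths F G k.
  by move=> uA; apply: (subvP (rescale_allowed c k)); apply: memv_img.
apply/subvP => _ /memv_imgP[u + ->].
rewrite /Omega !memv_cap -!memv_preim => /andP[uA duA].
by rewrite boundary_rescale !cA.
Qed.

Lemma rescale_cycles p : (rescale c p.+1 @: cycles w p <= cycles w' p)%VS.
Proof.
apply/subvP => _ /memv_imgP[u /memv_capP[uO uK] ->].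
rewrite memv_cap (subvP (rescale_Omega p)) ?memv_img //= memv_ker.
(* In degree 0 the truncated differential is zero, so only positive degrees use the intertwining
   relation. *)
move: uK; rewrite memv_ker /trunc_boundary; case: (p == 0)%N.
  by rewrite !zero_lfunE.
by rewrite boundary_rescale => /eqP ->; rewrite linear0.
Qed.

Lemma rescale_boundaries p :
  (rescale c p.+1 @: boundaries w p <= boundaries w' p)%VS.
Proof.
rewrite -limg_comp (rescale_boundary _ cw) limg_comp.
exact/limgS/rescale_Omega.
Qed.

Definition rescale_homology p :
  {linear path_homology w p -> path_homology w' p} :=
  quotv_map (rescale_cycles p) (rescale_boundaries p).

Lemma rescale_homologyE p z : z \in cycles w p ->
  rescale_homology p (quotv_pi (cycles w p) (boundaries w p) z) =
  quotv_pi (cycles w' p) (boundaries w' p) (rescale c p.+1 z).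
Proof. exact: quotv_mapE. Qed.

End RescaleHomology.

Lemma rescale_homologyK (F : fieldType) (G : digraph) (c d w w' : G -> F)
    (cw : forall i, c i * w' i = w i) (dw : forall i, d i * w i = w' i) p :
  (forall i, d i * c i = 1) ->
  cancel (rescale_homology cw p) (rescale_homology dw p).
Proof.
move=> dc x; have [z zZ ->] := quotv_piP x.
rewrite !rescale_homologyE ?rescaleK //.
by apply: (subvP (rescale_cycles cw p)); apply: memv_img.
Qed.

(** The inverse is the rescaling by [c^-1], which exchanges the roles of [w] and [w']. *)
Lemma rescale_homology_bij (F : fieldType) (G : digraph) (c w w' : G -> F)
    (cw : forall i, c i * w' i = w i) p :
  nonvanishing c -> bijective (rescale_homology cw p).
Proof.
move=> c0; have dw i : (c i)^-1 * w i = w' i by rewrite -cw mulKf.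
by exists (rescale_homology dw p); apply: rescale_homologyK => i;
  rewrite ?mulVf ?mulfV.
Qed.

Theorem theorem4p2 (F : fieldType) (N : option nat)
    (G : nat -> digraph) (f : forall n, G n -> G n.+1)
    (w w' : forall n, G n -> F)
    (w_neq0 : forall n, in_range N n -> nonvanishing (w n))
    (w'_neq0 : forall n, in_range N n -> nonvanishing (w' n))
    (hf : forall n, in_range N n.+1 ->
       wdigraph_morphism (w n) (w n.+1) (f n))
    (hf' : forall n, in_range N n.+1 ->
       wdigraph_morphism (w' n) (w' n.+1) (f n))
    (p : nat) :
  exists phi : forall n,
      {linear path_homology (w n) p -> path_homology (w' n) p},
    (forall n, in_range N n -> bijective (phi n)) /\
    (forall n (hn : in_range N n.+1) (x : path_homology (w n) p),
       phi n.+1 (homology_map (hf n hn) p x) =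
       homology_map (hf' n hn) p (phi n x)).
Proof.
pose c n i := w n i / w' n i.
have cw n (hn : in_range N n) i : c n i * w' n i = w n i.
  by rewrite /c divfK ?w'_neq0.
(* Outside the index set the weights may vanish, so the rescaling need not
   induce a map on homology there. *)
have phiP n : {phi : {linear path_homology (w n) p -> path_homology (w' n) p} |
    forall hn : in_range N n, phi = rescale_homology (cw n hn) p}.
  have [hn|nhn] : {in_range N n} + {~~ in_range N n}.
    by case: in_range; [left | right].
    (* The map is built from a proof of [in_range N n]; any two such proofs are equal, so the choice
       is immaterial. *)
    exists (rescale_homology (cw n hn) p) => hn'.
    by rewrite (bool_irrelevance hn' hn).
  by exists \0 => hn; rewrite hn in nhn.
exists (fun n => sval (phiP n)); split=> [n hn|n hn1 x].
  rewrite (svalP (phiP n) hn); apply: rescale_homology_bij => i.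
  by rewrite mulf_neq0 ?invr_eq0 ?w_neq0 ?w'_neq0.
have hn : in_range N n by case: (N) hn1 => //= m; apply: ltnW.
rewrite (svalP (phiP n) hn) (svalP (phiP n.+1) hn1).
have [z zZ ->] := quotv_piP x.
(* The induced maps are computed on representatives only for cycles, so both intermediate images of
   [z] must be cycles. *)
have fcz : push F (f n) p.+1 z \in cycles (w n.+1) p.
  by apply: (subvP (push_cycles (hf n hn1) p)); apply: memv_img.
have ccz : rescale (c n) p.+1 z \in cycles (w' n) p.
  by apply: (subvP (rescale_cycles (cw n hn) p)); apply: memv_img.
rewrite homology_mapE // !rescale_homologyE // homology_mapE //.
rewrite -[in LHS]comp_lfunE -[in RHS]comp_lfunE.
(* The square already commutes on chains, since [f n] preserves both weights and hence their
   ratio. *)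
rewrite (@rescale_push _ _ _ _ _ (c n.+1)) // => i.
by rewrite /c (morphism_weight (hf n hn1)) (morphism_weight (hf' n hn1)).
Qed.
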